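(* Let $C_{\mathrm{rib}}\subset\mathbb{P}^6$ be the (canonically embedded) genus 7 balanced ribbon. Then $C_{\mathrm{rib}}\cong P_{\mathrm{rib}}\cap\operatorname{OG}(5,10)$, where $P_{\mathrm{rib}}=\mathbb{P}(L)$ and $L\subset S^{+}$ is the 7-dimensional subspace spanned by $$e_{14}+e_{23},\quad \tfrac12e_{15}+e_{24},\quad 2e_{25}+e_{34},\quad e_{35},\quad e_{1245},\quad e_{12}+e_{1345},\quad e_{13}+e_{2345}.$$
   Context: Work over $\mathbb{C}$. The canonically embedded genus 7 balanced ribbon $C_{\mathrm{rib}}\subset\mathbb{P}^6$ is the (nonreduced) scheme defined by the ten quadrics $y_2y_3-2y_1y_4+y_0y_5$, $y_2y_4-2y_1y_5+y_0y_6$, $y_3^2-2y_2y_4+y_1y_5$, $y_3y_4-2y_2y_5+y_1y_6$, $-y_1^2+y_0y_2$, $-y_1y_2+y_0y_3$, $-y_2^2+y_1y_3$, $-y_4^2+y_3y_5$, $-y_4y_5+y_3y_6$, $-y_5^2+y_4y_6$. $S^{+}=\bigwedge^{\mathrm{even}}\operatorname{Span}(e_1,\dots,e_5)$ is the 16-dimensional half-spin representation, with basis $e_I=e_{i_1}\wedge\cdots\wedge e_{i_k}$ for $I=\{i_1<\cdots<i_k\}\subset\{1,\dots,5\}$ with $k$ even, and corresponding coordinates $x_I$ on $\mathbb{P}(S^{+})=\mathbb{P}^{15}$ (with $x_0$ for $I=\emptyset$). $\operatorname{OG}(5,10)\subset\mathbb{P}(S^{+})$ is the orthogonal Grassmannian,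 the subscheme defined by $x_0x_{2345}-x_{23}x_{45}+x_{24}x_{35}-x_{25}x_{34}$, $x_{12}x_{1345}-x_{13}x_{1245}+x_{14}x_{1235}-x_{15}x_{1234}$, $x_0x_{1345}-x_{13}x_{45}+x_{14}x_{35}-x_{15}x_{34}$, $x_{12}x_{2345}-x_{23}x_{1245}+x_{24}x_{1235}-x_{25}x_{1234}$, $x_0x_{1245}-x_{12}x_{45}+x_{14}x_{25}-x_{15}x_{24}$, $x_{13}x_{2345}-x_{23}x_{1345}+x_{34}x_{1235}-x_{35}x_{1234}$, $x_0x_{1235}-x_{12}x_{35}+x_{13}x_{25}-x_{15}x_{23}$, $x_{14}x_{2345}-x_{24}x_{1345}+x_{34}x_{1245}-x_{45}x_{1234}$, $x_0x_{1234}-x_{12}x_{34}+x_{13}x_{24}-x_{14}x_{23}$, $x_{15}x_{2345}-x_{25}x_{1345}+x_{35}x_{1245}-x_{45}x_{1235}$. The intersection is scheme-theoretic. *)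

(* Defs.v *)
From HB Require Import structures.
From mathcomp Require Import all_boot all_order all_algebra.
From mathcomp Require Import ring_quotient.
From mathcomp Require Import mpoly.
From mathcomp Require Import reals.
From mathcomp Require Import complex.

Set Implicit Arguments.
Unset Strict Implicit.
Unset Printing Implicit Defensive.

Import GRing.Theory.
Local Open Scope ring_scope.

(* Ideals are Prop-valued predicates; [ideal_add] is the sum of two ideals,
   i.e. the ideal of the scheme-theoretic intersection. *)
Section Ideals.
Variable A : comNzRingType.

Definition ideal_gen (G : A -> Prop) (f : A) : Prop :=
  exists2 r : seq (A * A),
    forall t, t \in r -> G t.2 & f = \sum_(t <- r) t.1 * t.2.

Definition ideal_add (I J : A -> Prop) (f : A) : Prop :=
  exists a b : A, [/\ I a, J b & f = a + b].

End Ideals.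

(* The ringed space Proj (S/I), for S = k[x_0,..,x_(n-1)] and I a homogeneous
   ideal: the closed subscheme of P^(n-1) cut out by I.  Homogeneous primes of
   S/I are encoded as the homogeneous primes of S containing I, and elements of
   S/I by representatives in S. *)
Section Proj.
Variables (k : fieldType) (n : nat) (I : {mpoly k[n]} -> Prop).

Record projPt := ProjPt {
  pideal : {pred {mpoly k[n]}};
  pideal_closed : idealr_closed pideal;  (* proper ideal *)
  pideal_prime : prime_idealr_closed pideal;
  pideal_homog : forall d f, f \in pideal -> pihomog mdeg d f \in pideal;
  pideal_sub : forall f, I f -> f \in pideal;
  pideal_relevant :
    exists d f, [/\ (0 < d)%N, f \is d.-homog for mdeg & f \notin pideal] }.

Definition zopen (U : projPt -> Prop) : Prop :=
  exists2 E : {mpoly k[n]} -> Prop, forall f, E f -> f \is homog mdeg &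
    forall p, U p <-> exists2 f, E f & f \notin pideal p.

(* (a, f) stands for a / f. *)
Definition hfrac := ({mpoly k[n]} * {mpoly k[n]})%type.

Definition frac_add (u v : hfrac) : hfrac :=
  (u.1 * v.2 + v.1 * u.2, u.2 * v.2).
Definition frac_mul (u v : hfrac) : hfrac := (u.1 * v.1, u.2 * v.2).
Definition frac_const (c : k) : hfrac := (c%:MP, 1).

(* The stalk at p is the homogeneous localization (S/I)_(p): the fractions
   satisfying [frac_at p], modulo the equivalence relation [frac_eq p]. *)
Definition frac_at (p : projPt) (u : hfrac) : Prop :=
  exists d, [/\ u.1 \is d.-homog for mdeg, u.2 \is d.-homog for mdeg &
                u.2 \notin pideal p].

Definition frac_eq (p : projPt) (u v : hfrac) : Prop :=
  exists h, [/\ h \is homog mdeg, h \notin pideal p &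
                I (h * (u.1 * v.2 - v.1 * u.2))].

(* The sections of the structure sheaf over an open U are the [s] satisfying
   [is_section U s], modulo [section_eq U]; only values of [s] on U matter. *)
Definition is_section (U : projPt -> Prop) (s : projPt -> hfrac) : Prop :=
  forall p, U p ->
    frac_at p (s p) /\
    exists V : projPt -> Prop, exists u : hfrac,
      [/\ zopen V, V p, (forall q, V q -> U q) &
          forall q, V q -> frac_at q u /\ frac_eq q (s q) u].

Definition section_eq (U : projPt -> Prop) (s t : projPt -> hfrac) : Prop :=
  forall p, U p -> frac_eq p (s p) (t p).

End Proj.

(* [phi] is a homeomorphism, and the [theta V] are isomorphisms of k-algebras
   O_Y(V) -> O_X(phi^-1 V) compatible with restriction.  An isomorphism of
   ringed spaces is automatically local on stalks. *)
Record is_proj_iso (k : fieldType) (n m : nat)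
    (I : {mpoly k[n]} -> Prop) (J : {mpoly k[m]} -> Prop)
    (phi : projPt I -> projPt J)
    (theta : (projPt J -> Prop) ->
             (projPt J -> hfrac k m) -> (projPt I -> hfrac k n)) : Prop :=
  IsProjIso {
  iso_bij : bijective phi;
  iso_open : forall V : projPt J -> Prop, zopen V <-> zopen (V \o phi);
  iso_section : forall V s, zopen V -> is_section V s ->
    is_section (V \o phi) (theta V s);
  iso_eq : forall V s t, zopen V -> is_section V s -> is_section V t ->
    (section_eq V s t <-> section_eq (V \o phi) (theta V s) (theta V t));
  iso_surj : forall V t, zopen V -> is_section (V \o phi) t ->
    exists2 s, is_section V s & section_eq (V \o phi) (theta V s) t;
  iso_add : forall V s t, zopen V -> is_section V s -> is_section V t ->
    section_eq (V \o phi) (theta V (fun q => frac_add (s q) (t q)))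
                          (fun p => frac_add (theta V s p) (theta V t p));
  iso_mul : forall V s t, zopen V -> is_section V s -> is_section V t ->
    section_eq (V \o phi) (theta V (fun q => frac_mul (s q) (t q)))
                          (fun p => frac_mul (theta V s p) (theta V t p));
  iso_const : forall V c, zopen V ->
    section_eq (V \o phi) (theta V (fun=> frac_const m c))
                          (fun=> frac_const n c);
  iso_restr : forall V W s, zopen V -> zopen W -> (forall q, W q -> V q) ->
    is_section V s -> section_eq (W \o phi) (theta W s) (theta V s) }.

Definition proj_isomorphic (k : fieldType) (n m : nat)
    (I : {mpoly k[n]} -> Prop) (J : {mpoly k[m]} -> Prop) : Prop :=
  exists (phi : projPt I -> projPt J) theta, is_proj_iso phi theta.

(* The ideal of P(L) in P^n, where P(L) is the space of lines in L: it is
   generated by the linear forms vanishing on L. *)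
Definition linear_subspace_ideal (k : fieldType) (n : nat)
    (L : {vspace 'rV[k]_n}) : {mpoly k[n]} -> Prop :=
  ideal_gen (fun l : {mpoly k[n]} => l \is 1.-homog for mdeg /\
                       forall v : 'rV[k]_n, v \in L -> l.@[v 0] = 0).

Section Ribbon.
Variable k : fieldType.

Definition ribbon_quadrics : seq {mpoly k[7]} :=
  let y0 : {mpoly k[7]} := 'X_(inord 0) in
  let y1 : {mpoly k[7]} := 'X_(inord 1) in
  let y2 : {mpoly k[7]} := 'X_(inord 2) in
  let y3 : {mpoly k[7]} := 'X_(inord 3) in
  let y4 : {mpoly k[7]} := 'X_(inord 4) in
  let y5 : {mpoly k[7]} := 'X_(inord 5) in
  let y6 : {mpoly k[7]} := 'X_(inord 6) in
  [:: y2 * y3 - 2 * y1 * y4 + y0 * y5;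
      y2 * y4 - 2 * y1 * y5 + y0 * y6;
      y3 ^+ 2 - 2 * y2 * y4 + y1 * y5;
      y3 * y4 - 2 * y2 * y5 + y1 * y6;
      - y1 ^+ 2 + y0 * y2;
      - (y1 * y2) + y0 * y3;
      - y2 ^+ 2 + y1 * y3;
      - y4 ^+ 2 + y3 * y5;
      - (y4 * y5) + y3 * y6;
      - y5 ^+ 2 + y4 * y6].

Definition ribbon_ideal : {mpoly k[7]} -> Prop :=
  ideal_gen (fun f => f \in ribbon_quadrics).

(* The even subsets of {1,..,5}, as increasing lists, ordering the basis e_I
   of S^+ and the coordinates x_I. *)
Definition even_subsets : seq (seq nat) :=
  [:: [::];
      [:: 1; 2]; [:: 1; 3]; [:: 1; 4]; [:: 1; 5]; [:: 2; 3];
      [:: 2; 4]; [:: 2; 5]; [:: 3; 4]; [:: 3; 5]; [:: 4; 5];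
      [:: 1; 2; 3; 4]; [:: 1; 2; 3; 5]; [:: 1; 2; 4; 5];
      [:: 1; 3; 4; 5]; [:: 2; 3; 4; 5]]%N.

Definition spin_index (s : seq nat) : 'I_16 := inord (index s even_subsets).

Definition spin_basis (s : seq nat) : 'rV[k]_16 := delta_mx 0 (spin_index s).

Definition spin_coord (s : seq nat) : {mpoly k[16]} := 'X_(spin_index s).

Definition og_quadrics : seq {mpoly k[16]} :=
  let x0 := spin_coord [::] in
  let x12 := spin_coord [:: 1; 2]%N in
  let x13 := spin_coord [:: 1; 3]%N in
  let x14 := spin_coord [:: 1; 4]%N in
  let x15 := spin_coord [:: 1; 5]%N in
  let x23 := spin_coord [:: 2; 3]%N in
  let x24 := spin_coord [:: 2; 4]%N in
  let x25 := spin_coord [:: 2; 5]%N in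
  let x34 := spin_coord [:: 3; 4]%N in
  let x35 := spin_coord [:: 3; 5]%N in
  let x45 := spin_coord [:: 4; 5]%N in
  let x1234 := spin_coord [:: 1; 2; 3; 4]%N in
  let x1235 := spin_coord [:: 1; 2; 3; 5]%N in
  let x1245 := spin_coord [:: 1; 2; 4; 5]%N in
  let x1345 := spin_coord [:: 1; 3; 4; 5]%N in
  let x2345 := spin_coord [:: 2; 3; 4; 5]%N in
  [:: x0 * x2345 - x23 * x45 + x24 * x35 - x25 * x34;
      x12 * x1345 - x13 * x1245 + x14 * x1235 - x15 * x1234;
      x0 * x1345 - x13 * x45 + x14 * x35 - x15 * x34;
      x12 * x2345 - x23 * x1245 + x24 * x1235 - x25 * x1234;
      x0 * x1245 - x12 * x45 + x14 * x25 - x15 * x24;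
      x13 * x2345 - x23 * x1345 + x34 * x1235 - x35 * x1234;
      x0 * x1235 - x12 * x35 + x13 * x25 - x15 * x23;
      x14 * x2345 - x24 * x1345 + x34 * x1245 - x45 * x1234;
      x0 * x1234 - x12 * x34 + x13 * x24 - x14 * x23;
      x15 * x2345 - x25 * x1345 + x35 * x1245 - x45 * x1235].

Definition og_ideal : {mpoly k[16]} -> Prop :=
  ideal_gen (fun f => f \in og_quadrics).

Definition ribbon_span : {vspace 'rV[k]_16} :=
  let e := spin_basis in
  let vs := [:: e [:: 1; 4]%N + e [:: 2; 3]%N;
                2^-1 *: e [:: 1; 5]%N + e [:: 2; 4]%N;
                2 *: e [:: 2; 5]%N + e [:: 3; 4]%N;
                e [:: 3; 5]%N;
                e [:: 1; 2; 4; 5]%N;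
                e [:: 1; 2]%N + e [:: 1; 3; 4; 5]%N;
                e [:: 1; 3]%N + e [:: 2; 3; 4; 5]%N] in
  <<vs>>%VS.

End Ribbon.

Arguments ribbon_ideal : clear implicits.
Arguments og_ideal : clear implicits.
Arguments ribbon_span : clear implicits.

(* Main.v *)
Require Import Defs.
From mathcomp Require Import all_boot all_order all_algebra.
From mathcomp Require Import mpoly reals complex.
From mathcomp Require Import ring_quotient boolp ring.

Set Implicit Arguments.
Unset Strict Implicit.
Unset Printing Implicit Defensive.

Import GRing.Theory.
Local Open Scope ring_scope.

(* Parametrize P(L) by coordinates y_0, .., y_6 with respect to a basis of L:
   x_I |-> (the I-th coordinate of the generic vector of L) maps k[x_I] onto
   k[y], kills the linear forms vanishing on L, and has the section sending y_j
   to a coordinate x_I that is dual to the j-th basis vector.  For a suitable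
   basis it sends the ten quadrics of OG(5,10) to +-1 or 2 times the ten quadrics
   of the ribbon.  Hence the two maps are graded and mutually inverse modulo the
   ideals, and such a pair of linear substitutions induces, by contraction of
   primes and substitution into fractions, mutually inverse isomorphisms of the
   Proj's. *)

(** * Ideals as predicates *)

Section IdealClosed.
Variable A : comNzRingType.
Implicit Types (I J : A -> Prop) (f g : A).

Definition ideal_closed I : Prop :=
  [/\ I 0, forall f g, I f -> I g -> I (f + g) & forall f g, I g -> I (f * g)].

Lemma ideal_closed_sum I (T : Type) (r : seq T) (P : pred T) (F : T -> A) :
  ideal_closed I -> (forall x, P x -> I (F x)) -> I (\sum_(x <- r | P x) F x).
Proof. by case=> I0 ID IM IF; elim/big_ind: _. Qed.

Lemma ideal_gen_closed (G : A -> Prop) : ideal_closed (ideal_gen G).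
Proof.
split=> [|f g [r rG ->] [s sG ->]|f g [r rG ->]].
- by exists [::] => //; rewrite big_nil.
- by exists (r ++ s) => [t|]; rewrite ?big_cat // mem_cat => /orP[/rG|/sG].
- exists [seq (f * t.1, t.2) | t <- r] => [_ /mapP[t /rG ? ->] //|].
  by rewrite big_map mulr_sumr; apply: eq_bigr => t _; rewrite mulrA.
Qed.

Lemma mem_ideal_gen (G : A -> Prop) f : G f -> ideal_gen G f.
Proof.
move=> Gf; exists [:: (1, f)] => [t|]; first by rewrite inE => /eqP->.
by rewrite big_seq1 mul1r.
Qed.

Lemma ideal_gen_ind (G I : A -> Prop) f :
  ideal_closed I -> (forall g, G g -> I g) -> ideal_gen G f -> I f.
Proof.
case=> I0 ID IM GI [r rG ->]; rewrite big_seq.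
by elim/big_ind: _ => // t /rG/GI; apply: IM.
Qed.

Lemma ideal_add_closed I J :
  ideal_closed I -> ideal_closed J -> ideal_closed (ideal_add I J).
Proof.
move=> [I0 ID IM] [J0 JD JM].
split=> [|_ _ [a [b [Ia Jb ->]]] [c [d [Ic Jd ->]]]|f _ [a [b [Ia Jb ->]]]].
- by exists 0, 0; rewrite addr0.
- by exists (a + c), (b + d); rewrite addrACA; split; [apply: ID|apply: JD|].
- by exists (f * a), (f * b); rewrite mulrDr; split; [apply: IM|apply: JM|].
Qed.

Lemma ideal_addl I J f : ideal_closed J -> I f -> ideal_add I J f.
Proof. by case=> J0 _ _ If; exists f, 0; rewrite addr0. Qed.

End IdealClosed.

(** Together with [ideal_gen_ind], this reduces to generators the check that a substitution carries
    one ideal into another. *)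
Lemma ideal_closed_preim (A B : comNzRingType) (h : {rmorphism A -> B})
  (I : B -> Prop) : ideal_closed I -> ideal_closed (fun f => I (h f)).
Proof.
move=> [I0 ID IM]; split=> [|f g|f g].
- by rewrite rmorph0.
- by rewrite rmorphD; apply: ID.
- by rewrite rmorphM; apply: IM.
Qed.

(** * Substitution of linear forms into polynomials *)

Section LinearSubstitution.
Variables (k : fieldType) (n m : nat) (t : n.-tuple {mpoly k[m]}).
Hypothesis t_lin : forall i, tnth t i \is 1.-homog for mdeg.

Lemma dhomog_comp_mpoly d (f : {mpoly k[n]}) :
  f \is d.-homog for mdeg -> f \mPo t \is d.-homog for mdeg.
Proof.
move=> /dhomogP f_d; rewrite comp_mpolyE big_seq; apply: rpred_sum => a af.
apply: dhomogZ; rewrite -(f_d a af) /= mdegE.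
elim/big_rec2: _ => [|i e p _ p_e]; first exact: dhomog1.
by apply: dhomogM p_e; have := dhomogMn (a i) (t_lin i); rewrite mul1n.
Qed.

(** Each monomial goes to a form of its own degree, so the degree [d] component can be extracted
    monomial by monomial. This makes the contraction of a homogeneous prime homogeneous. *)
Lemma pihomog_comp_mpoly d (f : {mpoly k[n]}) :
  pihomog mdeg d (f \mPo t) = pihomog mdeg d f \mPo t.
Proof.
rewrite comp_mpolyEX linear_sum pihomogE linear_sum [RHS]big_mkcond /=.
apply: eq_bigr => a _; rewrite !linearZ /=.
have Xt : 'X_[a] \mPo t \is (mdeg a).-homog for mdeg.
  by apply: dhomog_comp_mpoly; rewrite dhomogX.
case: eqP => [<-|/eqP ne]; first by rewrite pihomog_dE.
by rewrite (pihomog_ne0 ne) ?scaler0.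
Qed.

End LinearSubstitution.

(** Congruence modulo [J] respects sums and products, so only the variables have to be compared. *)
Lemma ideal_comp_mpolyB (k : fieldType) n (J : {mpoly k[n]} -> Prop)
    (t : n.-tuple {mpoly k[n]}) (f : {mpoly k[n]}) :
  ideal_closed J -> (forall i, J (tnth t i - 'X_i)) -> J (f \mPo t - f).
Proof.
move=> Jid tX; have [J0 JD JM] := Jid.
have JmulB (a b c d : {mpoly k[n]}) :
    J (a - b) -> J (c - d) -> J (a * c - b * d).
  move=> ab cd; have -> : a * c - b * d = c * (a - b) + b * (c - d) by ring.
  by apply: JD; apply: JM.
have JX i e : J (tnth t i ^+ e - 'X_i ^+ e).
  by elim: e => [|e IHe]; rewrite ?subrr // !exprS; apply: JmulB.
rewrite comp_mpolyE {3}(mpolyE f) -sumrB; apply: ideal_closed_sum => // a _.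
rewrite -scalerBr -mul_mpolyC; apply: JM; rewrite mpolyXE_id.
by elim/big_ind2: _ => // [|a1 a2 b1 b2]; [rewrite subrr|apply: JmulB].
Qed.

(** * Contraction of homogeneous primes and substitution into fractions *)

Section Pullback.
Variables (k : fieldType) (n m : nat).
Variables (I : {mpoly k[n]} -> Prop) (J : {mpoly k[m]} -> Prop).
Variables (t : m.-tuple {mpoly k[n]}) (u : n.-tuple {mpoly k[m]}).
Hypothesis I_ideal : ideal_closed I.
Hypothesis t_lin : forall i, tnth t i \is 1.-homog for mdeg.
Hypothesis u_lin : forall i, tnth u i \is 1.-homog for mdeg.
Hypothesis JI : forall f, J f -> I (f \mPo t).
Hypothesis utK : forall f, I (f \mPo u \mPo t - f).

Lemma pideal_congr (p : projPt I) f g :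
  I (f - g) -> (f \in pideal p) = (g \in pideal p).
Proof.
have [_ _ pD] := pideal_closed p => /(pideal_sub p) fg.
apply/idP/idP => [fp|gp].
  by have := pD (-1) _ _ fg fp; rewrite mulN1r opprB subrK; apply.
by have := pD 1 _ _ fg gp; rewrite mul1r subrK; apply.
Qed.

Definition preim_pideal (p : projPt I) : {pred {mpoly k[m]}} :=
  [pred f | f \mPo t \in pideal p].

Lemma preim_pideal_closed p : idealr_closed (preim_pideal p).
Proof.
have [p0 p1 pD] := pideal_closed p.
split=> [||a f g]; rewrite !inE ?comp_mpoly0 ?comp_mpoly1 //.
by rewrite rmorphD rmorphM; apply: pD.
Qed.

Lemma preim_pideal_prime p : prime_idealr_closed (preim_pideal p).
Proof. by move=> f g; rewrite !inE rmorphM => /(@pideal_prime _ _ _ p). Qed.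

Lemma preim_pideal_homog p d f :
  f \in preim_pideal p -> pihomog mdeg d f \in preim_pideal p.
Proof.
by rewrite !inE -pihomog_comp_mpoly //; apply: pideal_homog.
Qed.

Lemma preim_pideal_sub p f : J f -> f \in preim_pideal p.
Proof. by move=> /JI/(pideal_sub p); rewrite inE. Qed.

(** For a form [f] outside [p], the image of [f \mPo u] under [t] is congruent to [f] modulo [I],
    hence still outside [p]. Without such a [u], the contraction along a linear substitution could
    contain all forms of positive degree. *)
Lemma preim_pideal_relevant p :
  exists d f, [/\ (0 < d)%N, f \is d.-homog for mdeg & f \notin preim_pideal p].
Proof.
have [d [f [d0 fd fp]]] := pideal_relevant p.
exists d, (f \mPo u); split=> //; first exact: dhomog_comp_mpoly.
by rewrite inE (pideal_congr p (utK f)).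
Qed.

Definition proj_pullback (p : projPt I) : projPt J :=
  ProjPt (preim_pideal_closed p) (@preim_pideal_prime p)
    (@preim_pideal_homog p) (@preim_pideal_sub p) (preim_pideal_relevant p).

Definition frac_subst (a : hfrac k m) : hfrac k n := (a.1 \mPo t, a.2 \mPo t).

Lemma frac_at_subst p a :
  frac_at (proj_pullback p) a -> frac_at p (frac_subst a).
Proof.
by case=> d [a1 a2 ap]; exists d; split=> //; apply: dhomog_comp_mpoly.
Qed.

Lemma frac_eq_subst p a b :
  frac_eq (proj_pullback p) a b -> frac_eq p (frac_subst a) (frac_subst b).
Proof.
case=> h [/homogP[d hd] hp /JI]; rewrite rmorphM rmorphB !rmorphM => Ih.
exists (h \mPo t); split=> //; apply/homogP; exists d.
exact: dhomog_comp_mpoly.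
Qed.

Lemma frac_eq_refl p a : frac_eq (I := I) p a a.
Proof.
exists 1; rewrite subrr mulr0; have [_ p1 _] := pideal_closed p.
by split; [apply/homogP; exists 0%N; apply: dhomog1 | | case: I_ideal].
Qed.

(** Nonvanishing of [f] at the image of [p] is nonvanishing of [f \mPo t] at [p], so the substituted
    forms define the preimage. *)
Lemma zopen_pullback (V : projPt J -> Prop) :
  zopen V -> zopen (fun p => V (proj_pullback p)).
Proof.
case=> E Ehom VE; exists (fun g => exists2 f, E f & g = f \mPo t).
  move=> _ [f /Ehom/homogP[d fd] ->]; apply/homogP; exists d.
  exact: dhomog_comp_mpoly.
move=> p; rewrite VE; split=> [[f Ef fp]|[_ [f Ef ->] fp]]; last by exists f.
by exists (f \mPo t) => //; exists f.
Qed.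

Lemma is_section_subst (V : projPt J -> Prop) s : is_section V s ->
  is_section (fun p => V (proj_pullback p))
             (fun p => frac_subst (s (proj_pullback p))).
Proof.
move=> s_sec p Vp; have [s_p [W [a [Wo Wp WV Wa]]]] := s_sec _ Vp.
split; first exact: frac_at_subst.
exists (fun p => W (proj_pullback p)), (frac_subst a); split=> //.
- exact: zopen_pullback.
- by move=> q; apply: WV.
- by move=> q /Wa[??]; split; [apply: frac_at_subst|apply: frac_eq_subst].
Qed.

End Pullback.

(** * Isomorphisms of Proj from mutually inverse substitutions *)

Section ProjIso.
Variables (k : fieldType) (n m : nat).
Variables (I : {mpoly k[n]} -> Prop) (J : {mpoly k[m]} -> Prop).
Variables (t : m.-tuple {mpoly k[n]}) (u : n.-tuple {mpoly k[m]}).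
Hypothesis I_ideal : ideal_closed I.
Hypothesis J_ideal : ideal_closed J.
Hypothesis t_lin : forall i, tnth t i \is 1.-homog for mdeg.
Hypothesis u_lin : forall i, tnth u i \is 1.-homog for mdeg.
Hypothesis JI : forall f, J f -> I (f \mPo t).
Hypothesis IJ : forall f, I f -> J (f \mPo u).
Hypothesis utK : forall f, I (f \mPo u \mPo t - f).
Hypothesis tuK : forall f, J (f \mPo t \mPo u - f).

(** All fields of a point other than the prime itself are proofs, which proof irrelevance
    identifies. *)
Lemma projPt_inj : injective (@pideal k n I).
Proof.
case=> p a1 a2 a3 a4 a5 [q b1 b2 b3 b4 b5] /= pq.
case: _ / pq in b1 b2 b3 b4 b5 *.
by congr ProjPt; apply: Prop_irrelevance.
Qed.

Lemma proj_pullbackK :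
  cancel (proj_pullback t_lin u_lin JI utK) (proj_pullback u_lin t_lin IJ tuK).
Proof.
move=> p; apply: projPt_inj; apply: funext => f.
exact: (pideal_congr p (utK f)).
Qed.

Lemma frac_eq_substK p a : frac_eq (I := I) p (frac_subst t (frac_subst u a)) a.
Proof.
have [I0 ID IM] := I_ideal; have [_ p1 _] := pideal_closed p.
exists 1; split=> //; first by apply/homogP; exists 0%N; apply: dhomog1.
rewrite mul1r /=.
have BE (x x' y y' : {mpoly k[n]}) :
  x' * y - x * y' = y * (x' - x) + - x * (y' - y) by ring.
by rewrite BE; apply: ID; apply: IM; apply: utK.
Qed.

(** This is the injectivity of the pullback on sections. The relation over [I] is carried back to
    [J] by substituting [u]. *)
Lemma frac_eq_subst_inv p a b :
  frac_eq p (frac_subst t a) (frac_subst t b) ->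
  frac_eq (proj_pullback t_lin u_lin JI utK p) a b.
Proof.
have [J0 JD JM] := J_ideal.
case=> h [/homogP[d hd] hp /= Ih]; exists (h \mPo u); split.
- by apply/homogP; exists d; apply: dhomog_comp_mpoly.
- by rewrite /= inE (pideal_congr p (utK h)).
set c := _ - _; rewrite -!rmorphM -rmorphB /= -/c in Ih.
(* The first term is the image under [u] of an element of [I]; the second is a multiple of the error
   [c \mPo t \mPo u - c], which lies in [J] by [tuK]. *)
have -> : (h \mPo u) * c =
    (h \mPo u) * (c \mPo t \mPo u) + (- (h \mPo u)) * (c \mPo t \mPo u - c).
  by ring.
by apply: JD; [rewrite -rmorphM; apply: IJ | apply: JM; apply: tuK].
Qed.

End ProjIso.

Lemma proj_isomorphic_subst (k : fieldType) (n m : nat)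
    (I : {mpoly k[n]} -> Prop) (J : {mpoly k[m]} -> Prop)
    (t : m.-tuple {mpoly k[n]}) (u : n.-tuple {mpoly k[m]}) :
  ideal_closed I -> ideal_closed J ->
  (forall i, tnth t i \is 1.-homog for mdeg) ->
  (forall i, tnth u i \is 1.-homog for mdeg) ->
  (forall f, J f -> I (f \mPo t)) -> (forall f, I f -> J (f \mPo u)) ->
  (forall f, I (f \mPo u \mPo t - f)) -> (forall f, J (f \mPo t \mPo u - f)) ->
  proj_isomorphic I J.
Proof.
move=> I_ideal J_ideal t_lin u_lin JI IJ utK tuK.
pose phi := proj_pullback t_lin u_lin JI utK.
pose psi := proj_pullback u_lin t_lin IJ tuK.
have phiK : cancel phi psi := proj_pullbackK t_lin u_lin JI IJ utK tuK.
have psiK : cancel psi phi := proj_pullbackK u_lin t_lin IJ JI tuK utK.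
(* Seeing [V] as the [psi]-preimage of its [phi]-preimage lets the pullback lemmas for [psi] supply
   the converse for open sets and the surjectivity on sections. *)
have phiE (V : projPt J -> Prop) : V = (V \o phi) \o psi.
  by apply: funext => q /=; rewrite psiK.
(* The formula ignores the open set, so compatibility with restriction is reflexivity of
   [frac_eq]. *)
exists phi, (fun _ s p => frac_subst t (s (phi p))).
have refl p a : frac_eq (I := I) p a a by apply: frac_eq_refl.
split.
- by exists psi.
- move=> V; split; first exact: zopen_pullback.
  by move=> Vo; rewrite (phiE V); apply: (zopen_pullback u_lin t_lin IJ tuK).
- by move=> V s _; apply: is_section_subst.
- move=> V s r _ _ _; split=> sr.
    by move=> p /sr; apply: frac_eq_subst.
  move=> q; rewrite -(psiK q) => Vq; apply: frac_eq_subst_inv => //.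
  exact: sr.
- move=> V s Vo s_sec; exists (fun q => frac_subst u (s (psi q))).
    by rewrite (phiE V); apply: is_section_subst.
  by move=> p _; rewrite phiK; apply: frac_eq_substK.
- move=> V s r _ _ _ p _; rewrite /frac_add /frac_subst /=.
  by rewrite rmorphD !rmorphM.
- by move=> V s r _ _ _ p _; rewrite /frac_mul /frac_subst /= !rmorphM.
- by move=> V c _ p _; rewrite /frac_const /frac_subst /= comp_mpolyC comp_mpoly1.
- by move=> V W s _ _ _ _ p _; apply: refl.
Qed.

(** * Linear sections parametrized by a basis with dual coordinates *)

Lemma comp_mpolyA (k : fieldType) (n m l : nat) (t : n.-tuple {mpoly k[m]})
    (u : m.-tuple {mpoly k[l]}) (f : {mpoly k[n]}) :
  f \mPo t \mPo u = f \mPo [tuple tnth t i \mPo u | i < n].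
Proof.
rewrite [f \mPo t]comp_mpolyE linear_sum [RHS]comp_mpolyE; apply: eq_bigr => a _ /=.
rewrite linearZ rmorph_prod; congr (_ *: _); apply: eq_bigr => i _.
by rewrite tnth_mktuple rmorphXn.
Qed.

Section LinearSection.
Variables (k : fieldType) (n m : nat).
Variables (w : m.-tuple 'rV[k]_n) (c : 'I_m -> 'I_n).
Hypothesis wc : forall i j, tnth w i 0 (c j) = (i == j)%:R.

Definition span_param : n.-tuple {mpoly k[m]} :=
  [tuple \sum_(j < m) tnth w j 0 i *: 'X_j | i < n].

Definition span_coords : m.-tuple {mpoly k[n]} := [tuple 'X_(c j) | j < m].

(** By [wc], the entry of [v] at [c j] is the coefficient of the [j]-th spanning vector. *)
Lemma span_dual_coords v : v \in <<w>>%VS -> v = \sum_j v 0 (c j) *: tnth w j.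
Proof.
move=> /coord_span; set a := coord w => vE; rewrite {1}vE.
apply: eq_bigr => j _; rewrite (tnth_nth 0); congr (_ *: _).
rewrite {2}vE summxE (bigD1 j) //= big1 => [|i /negPf ij];
  by rewrite mxE -tnth_nth wc ?ij ?mulr0 // eqxx mulr1 addr0.
Qed.

Lemma span_free : free w.
Proof.
apply/freeP => a aw j; have := congr1 (fun v : 'rV_n => v 0 (c j)) aw.
rewrite summxE mxE (bigD1 j) //= big1 => [|i /negPf ij].
  by rewrite mxE -tnth_nth wc eqxx mulr1 addr0.
by rewrite mxE -tnth_nth wc ij mulr0.
Qed.

Lemma dhomogX1 (l : nat) (i : 'I_l) : ('X_i : {mpoly k[l]}) \is 1.-homog for mdeg.
Proof. by rewrite dhomogX /= mdeg1. Qed.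

Lemma span_param_lin i : tnth span_param i \is 1.-homog for mdeg.
Proof.
by rewrite tnth_mktuple; apply: rpred_sum => j _; apply/dhomogZ/dhomogX1.
Qed.

Lemma span_coords_lin i : tnth span_coords i \is 1.-homog for mdeg.
Proof. by rewrite tnth_mktuple dhomogX1. Qed.

Lemma comp_span_coordsK f : f \mPo span_coords \mPo span_param = f.
Proof.
rewrite comp_mpolyA -[RHS]comp_mpoly_id; congr (_ \mPo _).
apply: eq_from_tnth => j; rewrite !tnth_mktuple comp_mpolyXU -tnth_nth.
rewrite tnth_mktuple (bigD1 j) //= big1 => [|i /negPf ij].
  by rewrite wc eqxx scale1r addr0.
by rewrite wc ij scale0r.
Qed.

(** The only monomials of a linear form are variables. The formula shows that the parametrization
    kills every linear form vanishing on the span. *)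
Lemma comp_span_param_linear (l : {mpoly k[n]}) : l \is 1.-homog for mdeg ->
  l \mPo span_param = \sum_j l.@[tnth w j 0] *: 'X_j.
Proof.
move=> /dhomogP l_lin; rewrite comp_mpolyEX.
under [RHS]eq_bigr do rewrite mevalE scaler_suml.
rewrite exchange_big big_seq [RHS]big_seq; apply: eq_bigr => a /l_lin/eqP.
case/mdeg1P=> i /eqP->; rewrite comp_mpolyXU -tnth_nth tnth_mktuple.
rewrite scaler_sumr; apply: eq_bigr => j _.
by rewrite -mevalX mevalXU scalerA.
Qed.

Lemma comp_span_param_ideal (f : {mpoly k[n]}) :
  linear_subspace_ideal <<w>>%VS f -> f \mPo span_param = 0.
Proof.
pose Z (g : {mpoly k[m]}) := g = 0.
apply: (@ideal_gen_ind _ _ (fun f => Z (f \mPo span_param))).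
  apply: (ideal_closed_preim (comp_mpoly span_param)) => {f}.
  by split=> [|f g -> ->|f g ->]; rewrite /Z ?addr0 ?mulr0.
move=> l [l_lin l0]; rewrite /Z comp_span_param_linear // big1 // => j _.
by rewrite l0 ?scale0r // memv_span ?mem_tnth.
Qed.

(** It suffices to treat a variable: the difference is then a linear form which vanishes on the span
    by [span_dual_coords], hence a generator of the ideal. *)
Lemma comp_span_paramK (f : {mpoly k[n]}) :
  linear_subspace_ideal <<w>>%VS (f \mPo span_param \mPo span_coords - f).
Proof.
rewrite comp_mpolyA; apply: ideal_comp_mpolyB; first exact: ideal_gen_closed.
move=> i; apply: mem_ideal_gen; rewrite tnth_mktuple; split.
  apply: rpredB (dhomogX1 _).
  exact: dhomog_comp_mpoly span_coords_lin _ _ (span_param_lin i).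
move=> v /span_dual_coords vE; rewrite tnth_mktuple mevalB mevalXU {2}vE.
rewrite summxE (raddf_sum (comp_mpoly span_coords)) (raddf_sum (meval _)).
rewrite -sumrB big1 // => j _ /=.
rewrite linearZ /= comp_mpolyXU -tnth_nth tnth_mktuple mevalZ mevalXU mxE.
by rewrite mulrC subrr.
Qed.

Lemma linear_section_isomorphic (H : {mpoly k[m]} -> Prop)
    (G : {mpoly k[n]} -> Prop) :
  (forall g, G g -> ideal_gen H (g \mPo span_param)) ->
  (forall h, H h -> exists2 g, ideal_gen G g & g \mPo span_param = h) ->
  proj_isomorphic (ideal_gen H)
    (ideal_add (linear_subspace_ideal <<w>>%VS) (ideal_gen G)).
Proof.
move=> GH HG; have HI := ideal_gen_closed H; have GI := ideal_gen_closed G.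
have [H0 HD HM] := HI.
have LI : ideal_closed (linear_subspace_ideal <<w>>%VS) by apply: ideal_gen_closed.
have JI := ideal_add_closed LI GI; have [J0 JD JM] := JI.
apply: (@proj_isomorphic_subst _ _ _ _ _ span_param span_coords) => //.
- exact: span_param_lin.
- exact: span_coords_lin.
- move=> _ [a [b [/comp_span_param_ideal La Gb ->]]]; rewrite rmorphD /= La add0r.
  apply: (@ideal_gen_ind _ _ (fun f => ideal_gen H (f \mPo span_param))) Gb => //.
  exact: (ideal_closed_preim (comp_mpoly span_param)).
- move=> f.
  apply: (@ideal_gen_ind _ _ (fun f => ideal_add _ _ (f \mPo span_coords))).
    exact: (ideal_closed_preim (comp_mpoly span_coords)).
  (* The generator is the image of [g], so substituting [span_coords] into it gives [g] up to an
     element of the ideal of the span. *)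
  move=> _ /HG[g Gg <-]; rewrite -[_ \mPo span_coords](subrK g).
  exists (g \mPo span_param \mPo span_coords - g), g; split=> //.
  exact: comp_span_paramK.
- by move=> f; rewrite comp_span_coordsK subrr.
- by move=> f; apply: ideal_addl => //; apply: comp_span_paramK.
Qed.

End LinearSection.

(** * The spin coordinates on the ribbon section *)

Section RibbonSection.
Variable k : fieldType.

Lemma spin_index_eq s s' : s \in even_subsets -> s' \in even_subsets ->
  (spin_index s == spin_index s') = (s == s').
Proof.
have lt16 r : r \in even_subsets -> (index r even_subsets < 16)%N.
  by rewrite -index_mem.
move=> ss ss'; rewrite -(inj_eq (@ord_inj 16)) !inordK ?lt16 //.
apply/eqP/eqP => [e|-> //].
by rewrite -(nth_index [::] ss) e nth_index.
Qed.

(* The given basis of L with its second vector doubled, in the order that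
   matches y_0, .., y_6. *)
Definition ribbon_basis : 7.-tuple 'rV[k]_16 :=
  let e := spin_basis k in
  [tuple e [:: 1; 2; 4; 5]%N;
         e [:: 1; 2]%N + e [:: 1; 3; 4; 5]%N;
         e [:: 1; 3]%N + e [:: 2; 3; 4; 5]%N;
         e [:: 1; 4]%N + e [:: 2; 3]%N;
         e [:: 1; 5]%N + 2 *: e [:: 2; 4]%N;
         2 *: e [:: 2; 5]%N + e [:: 3; 4]%N;
         e [:: 3; 5]%N].

(** Each chosen coordinate has entry 1 in its own basis vector and 0 in the others; this rules out
    [x_24] and [x_25], where the entry is 2. *)
Definition ribbon_coord (j : 'I_7) : 'I_16 :=
  spin_index (nth [::] [:: [:: 1; 2; 4; 5]; [:: 1; 2]; [:: 1; 3]; [:: 1; 4];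
                           [:: 1; 5]; [:: 3; 4]; [:: 3; 5]]%N j).

Lemma spin_basisE s s' : s \in even_subsets -> s' \in even_subsets ->
  spin_basis k s 0 (spin_index s') = (s == s')%:R.
Proof. by move=> ss ss'; rewrite mxE eqxx spin_index_eq // eq_sym. Qed.

(** The comparisons of index sets stay symbolic, so that one formula serves all 16 coordinates and
    computation decides them once [s] is concrete. *)
Lemma ribbon_basisE s : s \in even_subsets ->
  [seq v 0 (spin_index s) | v : 'rV[k]_16 <- ribbon_basis] =
    [:: ([:: 1; 2; 4; 5] == s)%N%:R;
        ([:: 1; 2] == s)%N%:R + ([:: 1; 3; 4; 5] == s)%N%:R;
        ([:: 1; 3] == s)%N%:R + ([:: 2; 3; 4; 5] == s)%N%:R;
        ([:: 1; 4] == s)%N%:R + ([:: 2; 3] == s)%N%:R;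
        ([:: 1; 5] == s)%N%:R + 2 * ([:: 2; 4] == s)%N%:R;
        2 * ([:: 2; 5] == s)%N%:R + ([:: 3; 4] == s)%N%:R;
        ([:: 3; 5] == s)%N%:R].
Proof.
have addE (u v : 'rV[k]_16) i : (u + v) 0 i = u 0 i + v 0 i by rewrite mxE.
have mulE a (v : 'rV[k]_16) i : (a *: v) 0 i = a * v 0 i by rewrite mxE.
move=> ss; have := fun s' s'e => @spin_basisE s' s s'e ss; rewrite /ribbon_basis.
by move: (spin_basis k) (spin_index s) => e i eE; rewrite /= !addE !mulE !eE.
Qed.

Lemma ribbon_basis_coord i j :
  tnth ribbon_basis i 0 (ribbon_coord j) = (i == j)%:R.
Proof.
rewrite (tnth_nth 0) -(nth_map _ 0 (fun v : 'rV_16 => v 0 (ribbon_coord j)))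
  ?size_tuple // /ribbon_coord.
case: j => [[|[|[|[|[|[|[|j]]]]]]] // ?]; rewrite ribbon_basisE //;
case: i => [[|[|[|[|[|[|[|i]]]]]]] //= ?];
  by rewrite ?(addr0, add0r, mulr0).
Qed.

(** The two lists differ only in their order and in the factor 2 on one vector, which is
    invertible. *)
Lemma ribbon_span_basis : 2 != 0 :> k -> ribbon_span k = <<ribbon_basis>>%VS.
Proof.
move=> k2; rewrite /ribbon_span /ribbon_basis; move: (spin_basis k) => e.
set a := 2^-1 *: e _ + _; set b := e _ + 2 *: e _.
have ab : b = 2 *: a by rewrite scalerDr scalerA mulfV // scale1r.
have ba : a = 2^-1 *: b by rewrite ab scalerA mulVf // scale1r.
apply/eqP; rewrite eqEsubv; apply/andP; split; apply/span_subvP => v vin.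
  have [->|va] := eqVneq v a.
    by rewrite ba memvZ // memv_span // !inE eqxx ?orbT.
  by apply: memv_span; move: vin; rewrite !inE (negPf va) /=; do ?case: eqP => //.
have [->|vb] := eqVneq v b.
  by rewrite ab memvZ // memv_span // !inE eqxx ?orbT.
by apply: memv_span; move: vin; rewrite !inE (negPf vb) /=; do ?case: eqP => //.
Qed.

Lemma spin_coord_param s : s \in even_subsets ->
  spin_coord k s \mPo span_param ribbon_basis =
  ([:: 1; 2; 4; 5] == s)%N%:R * 'X_(inord 0)
  + (([:: 1; 2] == s)%N%:R + ([:: 1; 3; 4; 5] == s)%N%:R) * 'X_(inord 1)
  + (([:: 1; 3] == s)%N%:R + ([:: 2; 3; 4; 5] == s)%N%:R) * 'X_(inord 2)
  + (([:: 1; 4] == s)%N%:R + ([:: 2; 3] == s)%N%:R) * 'X_(inord 3)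
  + (([:: 1; 5] == s)%N%:R + 2 * ([:: 2; 4] == s)%N%:R) * 'X_(inord 4)
  + (2 * ([:: 2; 5] == s)%N%:R + ([:: 3; 4] == s)%N%:R) * 'X_(inord 5)
  + ([:: 3; 5] == s)%N%:R * 'X_(inord 6).
Proof.
move=> ss; rewrite comp_mpolyXU -tnth_nth tnth_mktuple.
(* Summing over natural numbers turns the variables into ['X_(inord j)], as in the quadrics, and
   lets the sum unfold into seven terms. *)
have -> : \sum_(j < 7) tnth ribbon_basis j 0 (spin_index s) *: 'X_j =
    \sum_(0 <= j < 7) [seq v 0 (spin_index s) | v : 'rV[k]_16 <- ribbon_basis]`_j
      *: ('X_(inord j) : {mpoly k[7]}).
  rewrite big_mkord; apply: eq_bigr => j _.
  by rewrite (nth_map 0) ?size_tuple // -tnth_nth inord_val.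
rewrite ribbon_basisE // unlock /= addr0 !addrA -!mul_mpolyC.
by rewrite !rmorphD !rmorphM !rmorph_nat.
Qed.

(** On [L] the coordinates [x_0], [x_45], [x_1234] and [x_1235] vanish, which removes one or two
    monomials from each quadric. The scalar 2 appears where [x_24 = 2 y_4] and [x_25 = 2 y_5] give a
    common factor. The list of indices is a permutation of 0, .., 9, so every ribbon quadric is
    reached. *)
Lemma og_quadrics_param i : (i < 10)%N ->
  (og_quadrics k)`_i \mPo span_param ribbon_basis =
  [:: 2; -1; 1; -1; 2; -1; -1; 1; -1; 1]`_i *:
    (ribbon_quadrics k)`_(nth 0 [:: 9; 4; 8; 5; 7; 6; 3; 0; 2; 1] i)%N.
Proof.
(* With the substitution and the variables replaced by opaque names, rewriting
   and [ring] do not unfold them. *)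
have [phi phiE] : exists phi : {rmorphism {mpoly k[16]} -> {mpoly k[7]}},
    phi =1 comp_mpoly (span_param ribbon_basis).
  by exists (comp_mpoly (span_param ribbon_basis)).
rewrite -phiE.
have := fun s ss => etrans (phiE (spin_coord k s)) (@spin_coord_param s ss).
rewrite /og_quadrics /ribbon_quadrics.
move: (spin_coord k) ('X_(inord 0)) ('X_(inord 1)) ('X_(inord 2)) ('X_(inord 3))
  ('X_(inord 4)) ('X_(inord 5)) ('X_(inord 6)) => x y0 y1 y2 y3 y4 y5 y6 xE.
case: i => [|[|[|[|[|[|[|[|[|[|i]]]]]]]]]] // _; cbv zeta; cbn [nth];
  rewrite ?(rmorphD, rmorphN, rmorphM) !xE //= ?(scaler_nat, scaleN1r, scale1r);
  rewrite ?(mul0r, mul1r, add0r, addr0, mulr0, mulr1); ring.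
Qed.

Lemma ribbon_section_isomorphic : 2 != 0 :> k ->
  proj_isomorphic (ribbon_ideal k)
    (ideal_add (linear_subspace_ideal (ribbon_span k)) (og_ideal k)).
Proof.
move=> k2; rewrite ribbon_span_basis //.
apply: (linear_section_isomorphic ribbon_basis_coord) => f /(nthP 0)[i i_lt <-].
  rewrite og_quadrics_param // -mul_mpolyC.
  have [_ _] := ideal_gen_closed (fun f => f \in ribbon_quadrics k); apply.
  apply/mem_ideal_gen/mem_nth.
  by move: i_lt; case: i => [|[|[|[|[|[|[|[|[|[|i]]]]]]]]]].
(* The permutation is inverted by taking for [j] the position of [i] in the list; [c] is 1, -1 or 2,
   hence invertible. *)
have [j [c [j_lt c0 E]]] : exists j c, [/\ (j < 10)%N, c != 0 &
      (og_quadrics k)`_j \mPo span_param ribbon_basis =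
      c *: (ribbon_quadrics k)`_i].
  have ji : (index i [:: 9; 4; 8; 5; 7; 6; 3; 0; 2; 1]%N < 10)%N
    by case: i i_lt => [|[|[|[|[|[|[|[|[|[|i]]]]]]]]]].
  have := og_quadrics_param ji; rewrite nth_index -?index_mem // => E.
  exists (index i [:: 9; 4; 8; 5; 7; 6; 3; 0; 2; 1]%N); eexists.
  split; [by []| |exact: E].
  by case: i i_lt {ji E} => [|[|[|[|[|[|[|[|[|[|i]]]]]]]]]] //=;
    rewrite ?oppr_eq0 oner_eq0.
exists (c^-1 *: (og_quadrics k)`_j).
  rewrite -mul_mpolyC.
  have [_ _] := ideal_gen_closed (fun f => f \in og_quadrics k); apply.
  exact/mem_ideal_gen/mem_nth.
by rewrite comp_mpolyZ E scalerA mulVf // scale1r.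
Qed.

End RibbonSection.

Theorem proposition4p1 (R : realType) :
  (\dim (ribbon_span R[i]%C) = 7)%N /\
  proj_isomorphic (ribbon_ideal R[i]%C)
    (ideal_add (linear_subspace_ideal (ribbon_span R[i]%C))
               (og_ideal R[i]%C)).
Proof.
have two_neq0 : 2 != 0 :> R[i]%C by rewrite Num.Theory.pnatr_eq0.
split; last exact: ribbon_section_isomorphic.
rewrite ribbon_span_basis //.
(* Freeness is by definition the equality of the dimension of the span with the length of the tuple,
   here 7. *)
by have /eqP := span_free (@ribbon_basis_coord R[i]%C).
Qed.
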